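(* For $n\in2\mathbb{Z}_{\ge0}$ put $\alpha_n=\prod_{\ell=0}^{n/2}(n-4\ell)$ and $\beta_n=\prod_{\ell=0}^{(n-2)/2}(n-2-4\ell)$. Then $$P_{\frac{n+2}{2}}(x;n)=\begin{cases}0 & \text{if } n\equiv0\pmod4,\\ \alpha_n\prod_{\ell=0}^{\frac{n-2}{4}}\big(x^2-(4\ell+1)^2\big) & \text{if } n\equiv2\pmod4,\end{cases}$$ and $$Q_{\frac n2}(x;n)=\begin{cases}\beta_n\prod_{\ell=0}^{\frac{n-4}{4}}\big(x^2-(4\ell+3)^2\big) & \text{if } n\equiv0\pmod4,\\ 0 & \text{if } n\equiv2\pmod4.\end{cases}$$
   Context: Put $a(x)=2x(2x-1)$ and $b(x)=2x(2x+1)$. $P_0(x;y)=Q_0(x;y)=1$. For $k\ge1$, $P_k(x;y)$ is the determinant of the $k\times k$ tridiagonal matrix with diagonal entries $(y-4(i-1))x$ in position $(i,i)$ $(1\le i\le k)$, entries $a(i)$ in position $(i,i+1)$, and entries $-a\left(\frac{y-2i+2}{2}\right)$ in position $(i+1,i)$ $(1\le i\le k-1)$. For $k\ge1$, $Q_k(x;y)$ is the determinant of the $k\times k$ tridiagonal matrix with diagonal entries $(y-2-4(i-1))x$ in position $(i,i)$ $(1\le i\le k)$, entries $b(i)$ in position $(i,i+1)$, and entries $-b\left(\frac{y-2i}{2}\right)$ in position $(i+1,i)$ $(1\le i\le k-1)$. Empty products $\prod_{\ell=j}^{j-1}$ are equal to $1$. *)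

(* Defs.v *)
From HB Require Import structures.
From mathcomp Require Import all_boot all_order all_algebra.

Set Implicit Arguments.
Unset Strict Implicit.
Unset Printing Implicit Defensive.

Import GRing.Theory.
Local Open Scope ring_scope.

(* The sequences [diag], [up] and [low] are indexed from 1: [diag i] is in
   position (i, i), [up i] in (i, i + 1) and [low i] in (i + 1, i), counting
   rows and columns from 1, whereas the ordinals below count from 0. *)
Definition tridiag (R : nzRingType) (k : nat) (diag up low : nat -> R) :
    'M[R]_k :=
  \matrix_(i < k, j < k)
    if j == i :> nat then diag i.+1
    else if j == i.+1 :> nat then up i.+1
    else if i == j.+1 :> nat then low j.+1
    else 0.

Definition a (F : fieldType) (x : F) : F := 2 * x * (2 * x - 1).
Definition b (F : fieldType) (x : F) : F := 2 * x * (2 * x + 1).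

(* For k = 0 both determinants are 1, by [det_mx00]. *)
Definition P (F : fieldType) (k : nat) (x y : F) : F :=
  \det (tridiag k
    (fun i => (y - 4 * (i%:R - 1)) * x)
    (fun i => a i%:R)
    (fun i => - a ((y - 2 * i%:R + 2) / 2))).

Definition Q (F : fieldType) (k : nat) (x y : F) : F :=
  \det (tridiag k
    (fun i => (y - 2 - 4 * (i%:R - 1)) * x)
    (fun i => b i%:R)
    (fun i => - b ((y - 2 * i%:R) / 2))).

Definition alpha (F : fieldType) (n : nat) : F :=
  \prod_(0 <= l < (n %/ 2).+1) (n%:R - 4 * l%:R).

(* The upper bound (n - 2) / 2 is -1 for n = 0, so it is expressed by the
   strict bound n / 2 to avoid truncated subtraction. *)
Definition beta (F : fieldType) (n : nat) : F :=
  \prod_(0 <= l < n %/ 2) (n%:R - 2 - 4 * l%:R).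

(* Main.v *)
Require Import Defs.
From HB Require Import structures.
From mathcomp Require Import all_boot all_order all_algebra.
From mathcomp Require Import ring zify.

Set Implicit Arguments.
Unset Strict Implicit.
Unset Printing Implicit Defensive.

Import GRing.Theory.
Local Open Scope ring_scope.

(** Write n = 2m and consider the representation of sl_2 on binary forms of
degree n in u, v, with E = u d/dv, F = v d/du and H = u d/du - v d/dv.  In the
monomial basis u^(n-j) v^j the operator x H + E^2 - F^2 preserves the parity of
j; its matrix on the even monomials is the one defining P_(m+1)(x; n), and on
the odd monomials the one defining Q_m(x; n).

Since E^2 - F^2 is half the anticommutator of E + F and E - F, it becomes
simpler in the weight basis of E + F, made of the forms (u+v)^(n-q) (u-v)^q:
there the operator sends the q-th vector to a combination of its two neighbours
(sl2_op_weight_vec).  The substitution v -> -v exchanges q and n - q,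
so that adding to each vector plus or minus its mirror image gives bases of the
even and odd parts, on which the operator is tridiagonal with zero diagonal
(sl2_mx_parity_mx).  The determinant of such a matrix is 0 in odd size, and in
even size it is the product over the pairs (2j, 2j+1) of minus the product of
the two off-diagonal entries (det_tridiag_diag0_odd, det_tridiag_diag0_even).
Each pair contributes the constant -(2j+1)(n-2j) times x^2 - (n-4j-1)^2,
except that in the even part the last pair, which contains the middle vector,
gives twice as much; the constants multiply up to alpha_n or beta_n (alpha_prod,
beta_prod).

Forms are dehomogenized by u = 1, v = 'X, so that E^2 and F^2 become second
order differential operators on polynomials of degree at most n.  The change of
basis is invertible because the q-th symmetrized vector is (1 - 'X^2)^q times a
polynomial that does not vanish at 1 (det_parity_mx). *)

(** * Tridiagonal matrices *)

Lemma eq_tridiag (R : nzRingType) k (d1 d2 u1 u2 l1 l2 : nat -> R) :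
  (forall i, (i < k)%N -> d1 i.+1 = d2 i.+1) ->
  (forall i, (i.+1 < k)%N -> u1 i.+1 = u2 i.+1) ->
  (forall i, (i.+1 < k)%N -> l1 i.+1 = l2 i.+1) ->
  tridiag k d1 u1 l1 = tridiag k d2 u2 l2.
Proof.
move=> eq_d eq_u eq_l; apply/matrixP=> i j; rewrite !mxE.
case: eqP => _; first exact: eq_d.
case: eqP => [ji | _]; first by apply: eq_u; rewrite -ji.
by case: eqP => [ij | _] //; apply: eq_l; rewrite -ij.
Qed.

Lemma tridiag_tr (R : nzRingType) k (d u l : nat -> R) :
  (tridiag k d u l)^T = tridiag k d l u.
Proof.
apply/matrixP=> i j; rewrite !mxE [i == j :> nat]eq_sym.
case: eqP => [-> // | _].
by do 2!case: eqP => // ?; lia.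
Qed.

(** [f] is a function on all of [nat] so that the neighbours [i.-1] and [i.+1]
need no bounds; the conditionals delete the entries outside the matrix. *)
Lemma sum_tridiag_row (R : comNzRingType) k (d u l f : nat -> R) (i : 'I_k) :
  \sum_(j < k) tridiag k d u l i j * f j =
    d i.+1 * f i + (if (i.+1 < k)%N then u i.+1 * f i.+1 else 0)
    + (if (0 < i)%N then l i * f i.-1 else 0).
Proof.
have pick (g : nat -> R) (m : nat) :
    \sum_(j < k) (if j == m :> nat then g j else 0)
    = if (m < k)%N then g m else 0.
  rewrite -big_mkcond; case: ltnP => [mk | km].
    by rewrite (big_pred1 (Ordinal mk)).
  by rewrite big_pred0 // => j; apply/eqP; have := ltn_ord j; lia.
pose g1 j := d i.+1 * f j; pose g2 j := u i.+1 * f j.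
pose g3 j := if (0 < i)%N then l i * f j else 0.
transitivity (\sum_(j < k) ((if j == i :> nat then g1 j else 0)
    + (if j == i.+1 :> nat then g2 j else 0)
    + (if j == i.-1 :> nat then g3 j else 0))).
  apply: eq_bigr => j _; rewrite mxE /g1 /g2 /g3.
  case: (altP (j =P i :> nat)) => [-> | ji].
    have -> : (i == i.+1 :> nat) = false by lia.
    case: eqP => i0; last by rewrite !addr0.
    by have -> : (0 < i)%N = false; [lia | rewrite !addr0].
  case: (altP (j =P i.+1 :> nat)) => [-> | ji1].
    by have -> : (i.+1 == i.-1 :> nat) = false; [lia | rewrite add0r addr0].
  have -> : (j == i.-1 :> nat) = (i == j.+1 :> nat) by lia.
  by rewrite !add0r; case: eqP => [-> | _] //; rewrite mul0r.
rewrite !big_split /= !pick ltn_ord /g1 /g2 /g3.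
by have -> : (i.-1 < k)%N by have := ltn_ord i; lia.
Qed.

Lemma sum_tridiag_col (R : comNzRingType) k (d u l f : nat -> R) (j : 'I_k) :
  \sum_(i < k) f i * tridiag k d u l i j =
    d j.+1 * f j + (if (j.+1 < k)%N then l j.+1 * f j.+1 else 0)
    + (if (0 < j)%N then u j * f j.-1 else 0).
Proof.
rewrite -sum_tridiag_row; apply: eq_bigr => i _.
by rewrite -[tridiag k d l u]tridiag_tr [in RHS]mxE mulrC.
Qed.

(** With a zero diagonal the first row and the first column have a single
possibly nonzero entry each, so expanding along both removes two rows and two
columns. *)
Lemma det_tridiag_diag0_rec (R : comNzRingType) k (u l : nat -> R) :
  \det (tridiag k.+2 (fun=> 0) u l) =
  - (u 1%N * l 1%N)
  * \det (tridiag k (fun=> 0) (fun i => u i.+2) (fun i => l i.+2)).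
Proof.
rewrite (expand_det_row _ ord0) (bigD1 (lift ord0 ord0)) //=.
rewrite big1 ?addr0; last first.
  by case=> [[|[|j]] jk] //= _; rewrite mxE /= mul0r.
rewrite mxE /= /cofactor /= expr1.
rewrite (expand_det_col _ ord0) (bigD1 ord0) //= big1 ?addr0; last first.
  by case=> [[|j] jk] //= _; rewrite !mxE /= mul0r.
rewrite !mxE /= /cofactor expr0 mul1r mulN1r mulrN mulrA mulNr.
congr (- (_ * \det _)).
by apply/matrixP=> i j; rewrite !mxE /= /bump /= !add1n !eqSS.
Qed.

Lemma det_tridiag_diag0_even (R : comNzRingType) k (u l : nat -> R) :
  \det (tridiag k.*2 (fun=> 0) u l) =
  \prod_(0 <= j < k) - (u j.*2.+1 * l j.*2.+1).
Proof.
elim: k u l => [|k IHk] u l; first by rewrite det_mx00 big_geq.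
by rewrite doubleS det_tridiag_diag0_rec IHk big_nat_recl.
Qed.

Lemma det_tridiag_diag0_odd (R : comNzRingType) k (u l : nat -> R) :
  \det (tridiag k.*2.+1 (fun=> 0) u l) = 0.
Proof.
elim: k u l => [|k IHk] u l; first by rewrite det_mx11 mxE.
by rewrite doubleS det_tridiag_diag0_rec IHk mulr0.
Qed.

(** * The operator x H + E^2 - F^2 *)

(** The operator x H + E^2 - F^2 on forms of degree [N], dehomogenized by u = 1,
v = 'X.  There H becomes N - 2 'X d and E becomes d, while F^2 becomes
'X^4 d^2 - 2 (N - 1) 'X^3 d + N (N - 1) 'X^2, because F maps 'X^j to
(N - j) 'X^(j+1). *)
Definition sl2_op (F : fieldType) (N : nat) (x : F) (p : {poly F}) : {poly F} :=
  x%:P * (N%:R * p - 2 * 'X * p^`())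
  + (1 - 'X ^+ 4) * p^`()^`() + 2 * (N%:R - 1) * 'X ^+ 3 * p^`()
  - N%:R * (N%:R - 1) * 'X ^+ 2 * p.

Lemma sl2_opD (F : fieldType) N (x : F) p q :
  sl2_op N x (p + q) = sl2_op N x p + sl2_op N x q.
Proof. by rewrite /sl2_op !derivD; ring. Qed.

Lemma sl2_opZ (F : fieldType) N (x c : F) p :
  sl2_op N x (c%:P * p) = c%:P * sl2_op N x p.
Proof. by rewrite /sl2_op !(derivM, derivC, mul0r, add0r); ring. Qed.

Lemma coef_sl2_op (F : fieldType) N (x : F) p j :
  (sl2_op N x p)`_j =
    (N%:R - 2 * j%:R) * x * p`_j + (j%:R + 2) * (j%:R + 1) * p`_j.+2
    - (if (1 < j)%N
       then (N%:R - j%:R + 2) * (N%:R - j%:R + 1) * p`_j.-2 else 0).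
Proof.
have E : sl2_op N x p =
  x%:P * ((N%:R)%:P * p - (2%:P * p^`()) * 'X)
  + (p^`()^`() - p^`()^`() * 'X^4)
  + ((2 * (N%:R - 1))%:P * p^`()) * 'X^3
  - ((N%:R * (N%:R - 1))%:P * p) * 'X^2.
  rewrite /sl2_op; ring.
rewrite E !(coefB, coefD, coefCM, coefMX, coefMXn, coef_deriv).
case: j => [|[|[|[|j]]]] /=; rewrite ?(subSS, subn0); ring.
Qed.

(** The form (u+v)^r (u-v)^q, a weight vector of weight r - q for E + F. *)
Definition weight_vec (F : fieldType) (r q : nat) : {poly F} :=
  (1 + 'X) ^+ r * (1 - 'X) ^+ q.

(** The logarithmic derivative of [weight_vec F r q] is r/(1+'X) - q/(1-'X).
Cleared of denominators, it lets every derivative of a weight vector be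
expressed by the vector itself, without the exponents r - 1 and q - 1. *)
Lemma weight_vec_ode (F : fieldType) r q (p := weight_vec F r q) :
  (1 - 'X ^+ 2) * p^`() = ((r%:R)%:P * (1 - 'X) - (q%:R)%:P * (1 + 'X)) * p.
Proof.
have derivX1 n c : (1 + c%:P * 'X) * ((1 + c%:P * 'X) ^+ n)^`() =
    n%:R * c%:P * (1 + c%:P * 'X) ^+ n :> {poly F}.
  case: n => [|n]; first by rewrite expr0 -polyC1 derivC; ring.
  rewrite deriv_exp derivD derivM -polyC1 !derivC derivX exprS /=; ring.
have dp := derivX1 r 1; have dm := derivX1 q (-1).
rewrite polyC1 mul1r in dp; rewrite polyCN polyC1 mulN1r in dm.
rewrite /p /weight_vec derivM.
transitivity (
  ((1 + 'X : {poly F}) * ((1 + 'X) ^+ r)^`()) * (1 - 'X) * (1 - 'X) ^+ q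
  + ((1 - 'X) * ((1 - 'X) ^+ q)^`()) * (1 + 'X) * (1 + 'X) ^+ r).
  ring.
rewrite dp dm; ring.
Qed.

(** In the basis of weight vectors, E + F acts by the weight w = r - q, while H
and E - F are the sum and the difference of the raising and lowering operators.
Half the anticommutator of E + F with a lowering operator from weight w to w - 2
multiplies it by w - 1, whence the coefficients.  After multiplication by
1 - 'X^2 both sides become multiples of one weight vector.  The truncated
predecessors are harmless, the coefficient being zero when they truncate. *)
Lemma sl2_op_weight_vec (F : fieldType) r q (x : F) :
  sl2_op (r + q) x (weight_vec F r q) =
    (r%:R * (x + r%:R - q%:R - 1))%:P * weight_vec F r.-1 q.+1
    + (q%:R * (x - r%:R + q%:R - 1))%:P * weight_vec F r.+1 q.-1.
Proof.
have nz : (1 - 'X ^+ 2 : {poly F}) != 0.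
  by rewrite -oppr_eq0 opprB -size_poly_eq0 size_XnsubC.
apply: (mulfI nz).
have ode := weight_vec_ode F r q.
have ode2 := congr1 (@deriv F) ode.
have shiftr : (r%:R)%:P * ((1 + 'X) * weight_vec F r.-1 q.+1) =
    (r%:R)%:P * ((1 - 'X) * weight_vec F r q).
  rewrite /weight_vec; case: r {ode ode2} => [|r] /=; last rewrite !exprS.
    by ring.
  by ring.
have shiftl : (q%:R)%:P * ((1 - 'X) * weight_vec F r.+1 q.-1) =
    (q%:R)%:P * ((1 + 'X) * weight_vec F r q).
  rewrite /weight_vec; case: q {ode ode2 shiftr} => [|q] /=; last rewrite !exprS.
    by ring.
  by ring.
move: (weight_vec F r.-1 q.+1) (weight_vec F r.+1 q.-1) shiftr shiftl.
move=> p1 p2 shiftr shiftl; move: (weight_vec F r q) ode ode2 shiftr shiftl => p.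
rewrite -!polyC1 !(derivM, derivB, derivD, derivXn, derivX, derivC) !polyC1 /=.
move=> ode ode2 shiftr shiftl.
(* The difference of the two sides is a combination of the relations [ode2],
   [ode], [shiftr] and [shiftl]: the multiplier of [ode2] is what eliminates the
   second derivative, and that of [ode] is the coefficient of the first
   derivative that remains. *)
apply/eqP; rewrite -subr_eq0; apply/eqP.
transitivity (
  (1 - 'X ^+ 2) * (1 + 'X ^+ 2)
    * ((0 - 'X^1 *+ 2) * p^`() + (1 - 'X^2) * (p^`())^`()
       - ((0 * (1 - 'X) + (r%:R)%:P * (0 - 1)
           - (0 * (1 + 'X) + (q%:R)%:P * (0 + 1))) * p
          + ((r%:R)%:P * (1 - 'X) - (q%:R)%:P * (1 + 'X)) * p^`()))
  + ((1 + 'X ^+ 2) * (r%:R - q%:R) + (2 - (r + q)%:R - 2 * x%:P) * 'X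
     + (r + q)%:R * 'X ^+ 3)
    * ((1 - 'X^2) * p^`() - ((r%:R)%:P * (1 - 'X) - (q%:R)%:P * (1 + 'X)) * p)
  - (x%:P + r%:R - q%:R - 1) * (1 - 'X)
    * ((r%:R)%:P * ((1 + 'X) * p1) - (r%:R)%:P * ((1 - 'X) * p))
  - (x%:P - r%:R + q%:R - 1) * (1 + 'X)
    * ((q%:R)%:P * ((1 - 'X) * p2) - (q%:R)%:P * ((1 + 'X) * p))).
  by rewrite /sl2_op; ring.
by rewrite ode2 ode shiftr shiftl !subrr !mulr0 !(addr0, subr0).
Qed.

(** * Symmetrized weight vectors *)

Lemma size_weight_vec (F : fieldType) r q :
  (size (weight_vec F r q) <= (r + q).+1)%N.
Proof.
have le2 (c : F) n : (size ((1 + c%:P * 'X) ^+ n)%R <= n.+1)%N.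
  apply: leq_trans (size_poly_exp_leq _ _) _; rewrite ltnS.
  rewrite -[leqRHS]mul1n leq_mul2r.
  apply/orP; right; have : (size (1 + c%:P * 'X)%R <= 2)%N; last by case: (size _).
  by rewrite addrC -polyC1 size_MXaddC; case: ifP => // _;
    rewrite ltnS size_polyC_leq1.
have := le2 1 r; have := le2 (-1) q.
rewrite polyCN polyC1 mulN1r mul1r => sq sr.
apply: leq_trans (size_polyMleq _ _) _.
by have := leq_add sr sq; rewrite addSn addnS; case: (_ + _)%N.
Qed.

Lemma coef_comp_polyNX (F : fieldType) (p : {poly F}) j :
  (p \Po - 'X)`_j = (-1) ^+ j * p`_j.
Proof.
elim/poly_ind: p j => [|p c IHp] j; first by rewrite comp_poly0 coef0 mulr0.
rewrite comp_poly_MXaddC mulrN !(coefD, coefN, coefC, coefMX).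
by case: j => [|j] /=; [ring | rewrite IHp exprS; ring].
Qed.

Lemma weight_vec_opp (F : fieldType) r q :
  weight_vec F r q \Po - 'X = weight_vec F q r.
Proof.
rewrite /weight_vec rmorphM !rmorphXn /= comp_polyB comp_polyD comp_polyX.
by rewrite -polyC1 comp_polyC opprK mulrC.
Qed.

(** The sum or difference of a weight vector and its mirror image, whose
monomials all have degree of parity [eps]. *)
Definition parity_vec (F : fieldType) N (eps : bool) q : {poly F} :=
  weight_vec F (N - q) q + ((-1) ^+ eps)%:P * weight_vec F q (N - q).

Lemma size_parity_vec (F : fieldType) N eps q :
  (q <= N)%N -> (size (parity_vec F N eps q) <= N.+1)%N.
Proof.
move=> qN; apply: leq_trans (size_polyD _ _) _.
rewrite geq_max; apply/andP; split.
  by have := size_weight_vec F (N - q) q; rewrite subnK.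
rewrite mul_polyC; apply: leq_trans (size_scale_leq _ _) _.
by have := size_weight_vec F q (N - q); rewrite subnKC.
Qed.

Lemma coef_parity_vec0 (F : fieldType) N (eps : bool) q j :
  odd j != eps -> (parity_vec F N eps q)`_j = 0.
Proof.
move=> odd_j; rewrite /parity_vec -weight_vec_opp coefD coefCM coef_comp_polyNX.
rewrite -signr_odd -mulrDl.
by case: eps (odd j) odd_j => [] [] // _; rewrite ?(addrN, addNr) mul0r.
Qed.

(** The mirror symmetry exchanges raising and lowering, so both summands of
[parity_vec] are multiplied by the same coefficients. *)
Lemma sl2_op_parity_vec (F : fieldType) N eps q (x : F) : (q <= N)%N ->
  sl2_op N x (parity_vec F N eps q) =
    ((N%:R - q%:R) * (x + N%:R - 2 * q%:R - 1))%:P * parity_vec F N eps q.+1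
    + (q%:R * (x - N%:R + 2 * q%:R - 1))%:P * parity_vec F N eps q.-1.
Proof.
move=> qN; rewrite /parity_vec sl2_opD sl2_opZ.
have := sl2_op_weight_vec (N - q) q x; have := sl2_op_weight_vec q (N - q) x.
rewrite subnK // subnKC // => -> ->; rewrite -subnS natrB //.
case: q qN => [|q] qN.
  rewrite subn0 /= !(mulr0n, mul0r, polyC0). ring.
have -> : (N - q.+1.-1 = (N - q.+1).+1)%N by lia.
rewrite /=; ring.
Qed.

(** The basis of the odd part stops at [m.-1] because of this vanishing. *)
Lemma parity_vec_mid_odd (F : fieldType) m : parity_vec F m.*2 true m = 0.
Proof.
by rewrite /parity_vec -addnn addnK expr1 polyCN polyC1 mulN1r subrr.
Qed.

(** At the middle vector, the last one of the even basis, the two neighbours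
coincide; this doubles one entry of the tridiagonal matrix. *)
Lemma parity_vec_mid_even (F : fieldType) m : (0 < m)%N ->
  parity_vec F m.*2 false m.+1 = parity_vec F m.*2 false m.-1.
Proof.
case: m => // m _; rewrite /parity_vec !mul1r addrC /=.
have -> : (m.+1.*2 - m.+2 = m)%N by lia.
by have -> : (m.+1.*2 - m = m.+2)%N by lia.
Qed.

(** Evaluating a relation at [z] kills all terms but the first, whose coefficient
must therefore vanish; then a factor [w] can be cancelled from the rest. *)
Lemma adic_free (F : fieldType) k (w : {poly F}) (z : F) (g : nat -> {poly F})
    (c : 'I_k -> F) :
  w != 0 -> root w z -> (forall q, (q < k)%N -> ~~ root (g q) z) ->
  \sum_(q < k) (c q)%:P * (w ^+ q * g q) = 0 -> forall q, c q = 0.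
Proof.
move=> w0 /rootP wz; elim: k g c => [|k IHk] g c gz; first by move=> _ [].
rewrite big_ord_recl /= expr0 mul1r.
under eq_bigr => q _ do rewrite /bump /= add1n exprS -mulrA mulrCA.
rewrite -mulr_sumr => sum0.
have c0 : c ord0 = 0.
  move/(congr1 (horner^~ z)): (sum0).
  rewrite hornerD !hornerM hornerC wz mul0r addr0 horner0 => /eqP.
  by rewrite mulf_eq0 => /orP[/eqP // |]; rewrite -rootE (negPf (gz _ _)).
move: sum0; rewrite c0 polyC0 mul0r add0r => /eqP.
rewrite mulf_eq0 (negPf w0) => /eqP /(IHk (fun q => g q.+1)) cS q.
case: (unliftP ord0 q) => [j -> | -> //].
by apply: cS => i ik; apply: gz.
Qed.

(** * The two tridiagonal forms *)

(** The matrix of [sl2_op m.*2 x] on the monomials 'X^(2i + eps), the index [i]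
starting from 0: there are [m + 1] even and [m] odd ones of degree at most 2m.
The formulas below are shifted, since [tridiag] counts from 1. *)
Definition sl2_mx (F : fieldType) m (eps : bool) (x : F) : 'M[F]_(m + ~~ eps) :=
  tridiag (m + ~~ eps)
    (fun i => ((m.*2)%:R - 2 * (2 * (i%:R - 1) + eps%:R)) * x)
    (fun i => (2 * i%:R + eps%:R) * (2 * i%:R + eps%:R - 1))
    (fun i => - (((m.*2)%:R - 2 * i%:R + 2 - eps%:R)
                 * ((m.*2)%:R - 2 * i%:R + 1 - eps%:R))).

(** The coefficients of the operator in the basis of symmetrized weight vectors.
The middle vector, of index [m], has two equal neighbours, hence the factor 2. *)
Definition kac_up (F : fieldType) m (x : F) i :=
  (if i == m then 2 else 1) * (i%:R * (x - (m.*2)%:R + 2 * i%:R - 1)).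

Definition kac_low (F : fieldType) m (x : F) i :=
  ((m.*2)%:R - i%:R + 1) * (x + (m.*2)%:R - 2 * i%:R + 1).

(** The change of basis: column [q] lists the coefficients of the [q]-th
symmetrized weight vector on the monomials of parity [eps]. *)
Definition parity_mx (F : fieldType) m (eps : bool) : 'M[F]_(m + ~~ eps) :=
  \matrix_(i, q) (parity_vec F m.*2 eps q)`_(i.*2 + eps).

(** Both sides compute the coefficients of the operator applied to symmetrized
weight vectors, in monomials on the left and in weight vectors on the right. *)
Lemma sl2_mx_parity_mx (F : fieldType) m eps (x : F) :
  sl2_mx m eps x *m parity_mx F m eps =
  parity_mx F m eps
  *m tridiag (m + ~~ eps) (fun=> 0) (kac_up m x) (kac_low m x).
Proof.
apply/matrixP => i q; rewrite !mxE.
have ik := ltn_ord i; have qk := ltn_ord q.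
have qm : (q <= m)%N by by lia.
transitivity (sl2_op m.*2 x (parity_vec F m.*2 eps q))`_(i.*2 + eps).
  under eq_bigr => j _ do rewrite [parity_mx _ _ _ _ _]mxE.
  rewrite (sum_tridiag_row _ _ _
    (fun j => (parity_vec F m.*2 eps q)`_(j.*2 + eps))).
  rewrite coef_sl2_op natrD -(muln2 i) natrM.
  have -> : ((1 < i * 2 + eps) = (0 < i))%N by lia.
  congr (_ + _ + _).
  - ring.
  - rewrite doubleS !addSn; case: ltnP => [_ | ki].
      by rewrite muln2; ring.
    (* Past the last row the degree exceeds m.*2. *)
    rewrite muln2 (leq_sizeP _ (m.*2.+1) _) ?mulr0 //.
      by apply: size_parity_vec; lia.
    by lia.
  - case: ifP => [i0 | _]; last by rewrite oppr0.
    have -> : ((i.-1).*2 + eps = (i * 2 + eps).-2)%N by lia.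
    by ring.
rewrite sl2_op_parity_vec; last by lia.
under eq_bigr => j _ do rewrite [parity_mx _ _ _ _ _]mxE.
rewrite (sum_tridiag_col _ _ _
  (fun j => (parity_vec F m.*2 eps j)`_(i.*2 + eps))).
rewrite mul0r add0r coefD !coefCM /kac_up /kac_low.
move: (i.*2 + eps)%N => j; move: (nat_of_ord q) qk qm => {i ik}{}q qk qm.
have [qm' | q_neq_m] := eqVneq q m.
  have eps0 : eps = false by move: qk; rewrite qm'; case: (eps) => //=; lia.
  rewrite qm' ifF; last by lia.
  rewrite -muln2 natrM muln2 eps0.
  case: posnP => [m0 | m0]; last by rewrite parity_vec_mid_even //; ring.
  by rewrite m0 !mulr0n; ring.
have -> : forall c : F, (if (0 < q)%N then 1 * (q%:R * c)
    * (parity_vec F m.*2 eps q.-1)`_j else 0) =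
    q%:R * c * (parity_vec F m.*2 eps q.-1)`_j.
  by move=> c; case: posnP => [-> | _]; ring.
case: ltnP => [_ | kq]; first by ring.
have [eps1 ->] : eps = true /\ q.+1 = m by move: kq; case: (eps) => /=; lia.
by rewrite eps1 parity_vec_mid_odd coef0 mulr0.
Qed.

(** A vector in the kernel gives a linear relation between the parity vectors,
because their coefficients of the other parity vanish; [adic_free] with
w = 1 - 'X^2 at the point 1 excludes it.  The cofactor [g q] takes there the
value 2^(N-2q), or 2 for the middle vector. *)
Lemma det_parity_mx (F : fieldType) m eps : (2 : F) != 0 ->
  \det (parity_mx F m eps) != 0.
Proof.
move=> two0; rewrite -det_tr; apply/det0P => -[v v0 vB].
case/negP: v0; apply/eqP.
pose N := m.*2.
pose g q : {poly F} :=
  (1 + 'X) ^+ (N - q.*2) + ((-1) ^+ eps)%:P * (1 - 'X) ^+ (N - q.*2).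
have fE q : (q < m + ~~ eps)%N ->
    parity_vec F N eps q = (1 - 'X ^+ 2) ^+ q * g q.
  move=> qk; have qm : (q <= m)%N by lia.
  have -> : 1 - 'X ^+ 2 = (1 + 'X) * (1 - 'X) :> {poly F} by ring.
  rewrite /parity_vec /weight_vec /g exprMn.
  have -> : (N - q = q + (N - q.*2))%N by rewrite /N; lia.
  by rewrite !exprD; ring.
suff c0 : forall q, v 0 q = 0 by apply/rowP => q; rewrite c0 mxE.
apply: (@adic_free F _ (1 - 'X ^+ 2) 1 g).
- by rewrite -oppr_eq0 opprB -size_poly_eq0 size_XnsubC.
- by rewrite rootE !hornerE expr1n subrr.
- move=> q qk; rewrite rootE /g !hornerE subrr expr0n.
  case: (eqVneq (N - q.*2)%N 0%N) => [Nq | _]; last first.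
    by rewrite mulr0 addr0 expf_neq0.
  have [em qm] : eps = false /\ q = m.
    by move: qk Nq; rewrite /N; case: (eps) => /=; lia.
  by rewrite em mulr1 Nq.
apply/polyP => j; rewrite coef0 coef_sum.
under eq_bigr => q _ do rewrite coefCM -fE //.
have [odd_j | /coef_parity_vec0 odd_j] := eqVneq (odd j) eps; last first.
  by rewrite big1 // => q _; rewrite odd_j mulr0.
have [jk | kj] := ltnP j./2 (m + ~~ eps).
  have jE : (j./2.*2 + eps = j)%N by rewrite -odd_j addnC odd_double_half.
  move/rowP/(_ (Ordinal jk)): vB; rewrite !mxE => vBj; rewrite -[RHS]vBj.
  by apply: eq_bigr => q _; rewrite !mxE /= jE.
rewrite big1 // => q _; rewrite (leq_sizeP _ N.+1 _) ?mulr0 //.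
  by apply: size_parity_vec; have := ltn_ord q; rewrite /N; lia.
by have := odd_double_half j; rewrite odd_j /N; lia.
Qed.

Lemma det_sl2_mx (F : fieldType) m eps (x : F) : (2 : F) != 0 ->
  \det (sl2_mx m eps x) =
  \det (tridiag (m + ~~ eps) (fun=> 0) (kac_up m x) (kac_low m x)).
Proof.
move=> two0; apply: (mulIf (det_parity_mx m eps two0)).
by rewrite -det_mulmx sl2_mx_parity_mx det_mulmx mulrC.
Qed.

(** * Evaluation of the determinants *)

Lemma P_sl2_mx (F : fieldType) m (x : F) : (2 : F) != 0 ->
  P m.+1 x (m.*2)%:R = \det (sl2_mx m false x).
Proof.
move=> two0; rewrite /P /sl2_mx addn1; congr (\det _).
apply: eq_tridiag => i _; rewrite /a /=; first by ring.
  by ring.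
by field.
Qed.

Lemma Q_sl2_mx (F : fieldType) m (x : F) : (2 : F) != 0 ->
  Q m x (m.*2)%:R = \det (sl2_mx m true x).
Proof.
move=> two0; rewrite /Q /sl2_mx addn0; congr (\det _).
apply: eq_tridiag => i _; rewrite /b /=; first by ring.
  by ring.
by field.
Qed.

(** The two products share all factors but one: the first factor 4h+4 on the left
is twice the last factor 2h+2 on the right. *)
Lemma prod_even_top (F : fieldType) h :
  \prod_(0 <= j < h.+1) ((4 * h.+1)%:R - 2 * j%:R) =
  2 * \prod_(0 <= j < h.+1) ((4 * h + 2)%:R - 2 * j%:R) :> F.
Proof.
rewrite big_nat_recl // big_nat_recr //=.
under eq_bigr => j _ do
  have -> : (4 * h.+1)%:R - 2 * j.+1%:R = (4 * h + 2)%:R - 2 * j%:R :> F by ring.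
ring.
Qed.

(** Going from h to h + 1 shifts the arithmetic progression of factors and adds
4h+2 at one end and -(4h+2) at the other. *)
Lemma beta_rec (F : fieldType) h :
  beta F (4 * h.+1) = - (4 * h + 2)%:R ^+ 2 * beta F (4 * h).
Proof.
rewrite /beta.
have -> : ((4 * h.+1) %/ 2 = (h.*2).+2)%N by lia.
have -> : ((4 * h) %/ 2 = h.*2)%N by lia.
rewrite big_nat_recl // big_nat_recr //=.
under eq_bigr => j _ do
  have -> : (4 * h.+1)%:R - 2 - 4 * j.+1%:R = (4 * h)%:R - 2 - 4 * j%:R :> F by ring.
rewrite -muln2; ring.
Qed.

Lemma prod_opp_split (F : fieldType) h (y : F) :
  \prod_(0 <= j < h) - ((2 * j%:R + 1) * (y - 2 * j%:R)) =
  (\prod_(0 <= j < h) - (2 * j%:R + 1)) * \prod_(0 <= j < h) (y - 2 * j%:R).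
Proof. by rewrite -big_split; apply: eq_bigr => j _; rewrite /= mulNr. Qed.

(** By [prod_even_top], passing from h to h + 1 multiplies the right-hand side by
-(2h+1) times 2 (4h+2), which is the factor in [beta_rec]. *)
Lemma beta_prod (F : fieldType) h :
  beta F (4 * h) =
  \prod_(0 <= j < h) - ((2 * j%:R + 1) * ((4 * h)%:R - 2 * j%:R)).
Proof.
rewrite prod_opp_split; elim: h => [|h IHh].
  by rewrite /beta !big_geq // mulr1.
rewrite beta_rec IHh prod_even_top.
rewrite [in RHS]big_nat_recr // [\prod_(0 <= _ < h.+1) _]big_nat_recl //=.
have -> : \prod_(0 <= j < h) ((4 * h + 2)%:R - 2 * j.+1%:R) =
    \prod_(0 <= j < h) ((4 * h)%:R - 2 * j%:R) :> F.
  by apply: eq_bigr => j _; ring.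
ring.
Qed.

Lemma alpha_prod (F : fieldType) h :
  alpha F (4 * h + 2) =
  2 * \prod_(0 <= j < h.+1) - ((2 * j%:R + 1) * ((4 * h + 2)%:R - 2 * j%:R)).
Proof.
(* Both products have the same factors: n - 4l = (n + 2) - 2 - 4l. *)
transitivity (beta F (4 * h.+1)).
  rewrite /alpha /beta.
  have -> : (((4 * h + 2) %/ 2).+1 = (4 * h.+1) %/ 2)%N by lia.
  by apply: eq_bigr => j _; ring.
by rewrite beta_prod !prod_opp_split prod_even_top mulrCA.
Qed.

Lemma P_zero (F : fieldType) h (x : F) : (2 : F) != 0 ->
  P (h.*2).+1 x (h.*2.*2)%:R = 0.
Proof.
by move=> two0; rewrite P_sl2_mx // det_sl2_mx //= addn1 det_tridiag_diag0_odd.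
Qed.

Lemma Q_zero (F : fieldType) h (x : F) : (2 : F) != 0 ->
  Q (h.*2).+1 x (h.*2.+1.*2)%:R = 0.
Proof.
by move=> two0; rewrite Q_sl2_mx // det_sl2_mx //= addn0 det_tridiag_diag0_odd.
Qed.

(** The pair (2j, 2j+1) contributes x^2 - (4(h-j)+1)^2, so the right-hand
product is reindexed in reverse order; the last pair contains the doubled
entry. *)
Lemma P_prod (F : fieldType) h (x : F) : (2 : F) != 0 ->
  P (h.*2).+2 x (h.*2.+1.*2)%:R =
  alpha F (4 * h + 2) * \prod_(0 <= l < h.+1) (x ^+ 2 - (4 * l%:R + 1) ^+ 2).
Proof.
move=> two0; rewrite P_sl2_mx // det_sl2_mx //= addn1 -doubleS.
rewrite det_tridiag_diag0_even alpha_prod.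
rewrite [\prod_(0 <= l < h.+1) (x ^+ 2 - _)]big_nat_rev.
rewrite -mulrA -big_split !(big_nat_recr h) //= [RHS]mulrCA.
have hE : (h.*2.+1.*2)%:R = 4 * h%:R + 2 :> F by rewrite -!muln2; ring.
congr (_ * _); last first.
  rewrite /kac_up /kac_low eqxx hE -muln2 add0n subnn; ring.
rewrite !big_nat; apply: eq_bigr => j /= jh.
rewrite /kac_up /kac_low ifF; last by lia.
rewrite add0n subSS natrB ?(ltnW jh) // hE -muln2; ring.
Qed.

Lemma Q_prod (F : fieldType) h (x : F) : (2 : F) != 0 ->
  Q h.*2 x (h.*2.*2)%:R =
  beta F (4 * h) * \prod_(0 <= l < h) (x ^+ 2 - (4 * l%:R + 3) ^+ 2).
Proof.
move=> two0; rewrite Q_sl2_mx // det_sl2_mx //= addn0.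
rewrite det_tridiag_diag0_even beta_prod.
rewrite [\prod_(0 <= l < h) (x ^+ 2 - _)]big_nat_rev -big_split.
have hE : (h.*2.*2)%:R = 4 * h%:R :> F by rewrite -!muln2; ring.
rewrite !big_nat; apply: eq_bigr => j /= jh.
rewrite /kac_up /kac_low ifF; last by lia.
rewrite add0n natrB // hE -muln2; ring.
Qed.

Theorem theorem7p18 (F : fieldType) (F_char0 : [pchar F] =i pred0)
    (n : nat) (n_even : ~~ odd n) (x : F) :
  [/\ (n = 0 %[mod 4])%N -> P ((n + 2) %/ 2) x n%:R = 0,
      (n = 2 %[mod 4])%N ->
        P ((n + 2) %/ 2) x n%:R =
          alpha F n *
          \prod_(0 <= l < ((n - 2) %/ 4).+1) (x ^+ 2 - (4 * l%:R + 1) ^+ 2),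
      (n = 0 %[mod 4])%N ->
        Q (n %/ 2) x n%:R =
          beta F n * \prod_(0 <= l < n %/ 4) (x ^+ 2 - (4 * l%:R + 3) ^+ 2)
    & (n = 2 %[mod 4])%N -> Q (n %/ 2) x n%:R = 0].
Proof.
have two0 : (2 : F) != 0.
  by apply/negP => two0; have := F_char0 2%N; rewrite !inE /= two0.
pose h := (n %/ 4)%N.
split=> n_mod.
- have -> : n = h.*2.*2 by lia.
  by have -> : ((h.*2.*2 + 2) %/ 2 = h.*2.+1)%N; [lia | apply: P_zero].
- have nE : n = (4 * h + 2)%N by lia.
  have -> : ((n + 2) %/ 2 = h.*2.+2)%N by lia.
  have -> : ((n - 2) %/ 4 = h)%N by lia.
  rewrite nE -P_prod //; congr (P _ _ _%:R); lia.
- have nE : n = (4 * h)%N by lia.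
  have -> : (n %/ 2 = h.*2)%N by lia.
  rewrite -/h nE -Q_prod //; congr (Q _ _ _%:R); lia.
- have -> : n = h.*2.+1.*2 by lia.
  by have -> : ((h.*2.+1.*2) %/ 2 = h.*2.+1)%N; [lia | apply: Q_zero].
Qed.
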